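(* Let $k:A\to B$ be a pure inclusion of unital associative algebras over a field $\mathbb{F}$. If $B$ is finitely generated over $A$ (as a right $A$-module via $k$), then the restriction of scalars functor $k^*:\mathrm{Rep}(B)\to\mathrm{Rep}(A)$ is dominant.
   Context: $\mathrm{Rep}(A)$ denotes the category of finite-dimensional left $A$-modules. An inclusion $k:M\to M'$ of right $A$-modules is pure if for every $N\in\mathrm{Rep}(A)$ the map $k\otimes\mathrm{id}_N:M\otimes_A N\to M'\otimes_A N$ is injective; an algebra inclusion $k:A\to B$ is pure if it is pure as an inclusion of right $A$-modules. A functor $F:\mathcal{C}\to\mathcal{D}$ is dominant if for every object $d\in\mathcal{D}$ there is an object $c\in\mathcal{C}$ such that $d$ is (isomorphic to) a subobject of $F(c)$. *)

(* Defs.v *)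
From HB Require Import structures.
From mathcomp Require Import all_boot ssralg ssrint generic_quotient ring_quotient.
From mathcomp Require Import boolp.
From mathcomp.multinomials Require Import freeg.

Set Implicit Arguments.
Unset Strict Implicit.
Unset Printing Implicit Defensive.

Import GRing.Theory.

Local Open Scope ring_scope.
Local Open Scope quotient_scope.

Record category := Category {
  object :> Type;
  hom : object -> object -> Type;
  idmor : forall x, hom x x;
  compose : forall x y z, hom y z -> hom x y -> hom x z;
  compose_idl : forall x y (f : hom x y), compose (idmor y) f = f;
  compose_idr : forall x y (f : hom x y), compose f (idmor x) = f;
  compose_assoc : forall x y z t (h : hom z t) (g : hom y z) (f : hom x y),
    compose h (compose g f) = compose (compose h g) f
}.

Record functor (C D : category) := Functor {
  on_obj :> C -> D;
  on_hom : forall x y, hom x y -> hom (on_obj x) (on_obj y);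
  on_hom_id : forall x, on_hom (idmor x) = idmor (on_obj x);
  on_hom_comp : forall x y z (g : hom y z) (f : hom x y),
    on_hom (compose g f) = compose (on_hom g) (on_hom f)
}.

Definition monomorphism (C : category) (x y : C) (f : hom x y) : Prop :=
  forall (w : C) (g h : hom w x), compose f g = compose f h -> g = h.

Definition dominant (C D : category) (F : functor C D) : Prop :=
  forall d : D, exists (c : C) (f : hom d (F c)), monomorphism f.

Definition restrict (R S : pzRingType) (f : R -> S) (V : Type) : Type := V.

Section Restrict.
Variables (R S : pzRingType) (f : {rmorphism R -> S}).

Section Module.
Variable V : lmodType S.

HB.instance Definition _ := GRing.Zmodule.on (restrict f V).

Definition restrict_scale (r : R) (v : restrict f V) : restrict f V :=
  f r *: (v : V).

Fact restrict_scaleA a b v :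
  restrict_scale a (restrict_scale b v) = restrict_scale (a * b) v.
Proof. by rewrite /restrict_scale scalerA rmorphM. Qed.

Fact restrict_scale1 : left_id 1 restrict_scale.
Proof. by move=> v; rewrite /restrict_scale rmorph1 scale1r. Qed.

Fact restrict_scaleDr : right_distributive restrict_scale +%R.
Proof. by move=> a u v; apply: scalerDr. Qed.

Fact restrict_scaleDl v : {morph restrict_scale^~ v : a b / a + b}.
Proof. by move=> a b; rewrite /restrict_scale rmorphD scalerDl. Qed.

HB.instance Definition _ := GRing.Zmodule_isLmodule.Build R (restrict f V)
  restrict_scaleA restrict_scale1 restrict_scaleDr restrict_scaleDl.

End Module.

Section Morphism.
Variables (V W : lmodType S) (g : {linear V -> W}).

Definition restrict_map (v : restrict f V) : restrict f W := g v.

Fact restrict_map_linear : linear restrict_map.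
Proof. by move=> a u v; apply: (linearP g). Qed.

HB.instance Definition _ :=
  GRing.isLinear.Build R (restrict f V) (restrict f W) _ restrict_map
    restrict_map_linear.

End Morphism.
End Restrict.

Arguments restrict_map {R S} f {V W} g v.

Definition finitely_generated (R : pzRingType) (M : lmodType R) : Prop :=
  exists (n : nat) (e : 'I_n -> M),
    forall x, exists c : 'I_n -> R, x = \sum_i c i *: e i.

(* The F-linear structure of a module over an F-algebra A is the restriction *)
(* of its A-linear structure along F -> A.                                   *)
Definition finite_dimensional (F : fieldType) (A : algType F)
    (V : lmodType A) : Prop :=
  finitely_generated (restrict (in_alg A) V).

Record rep (F : fieldType) (A : algType F) := Rep {
  rep_module :> lmodType A;
  rep_fin_dim : finite_dimensional rep_module
}.

Lemma linear_ext (R : pzRingType) (V W : lmodType R) (f g : {linear V -> W}) :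
  f =1 g -> f = g.
Proof.
case: f g => [f [[fD] [fZ]]] [g [[gD] [gZ]]] /= /funext fg.
by case: _ / fg in gD gZ *; rewrite (Prop_irrelevance fD gD) (Prop_irrelevance fZ gZ).
Qed.

Section RepCategory.
Variables (F : fieldType) (A : algType F).
Implicit Types V W : rep A.

Definition rep_hom V W : Type := {linear V -> W}.
Definition rep_id V : rep_hom V V := idfun.
Definition rep_comp U V W (g : rep_hom V W) (f : rep_hom U V) : rep_hom U W :=
  g \o f.

Fact rep_comp_idl V W (f : rep_hom V W) : rep_comp (rep_id W) f = f.
Proof. exact: linear_ext. Qed.

Fact rep_comp_idr V W (f : rep_hom V W) : rep_comp f (rep_id V) = f.
Proof. exact: linear_ext. Qed.

Fact rep_comp_assoc T U V W (h : rep_hom V W) (g : rep_hom U V)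
  (f : rep_hom T U) : rep_comp h (rep_comp g f) = rep_comp (rep_comp h g) f.
Proof. exact: linear_ext. Qed.

Definition RepCat : category :=
  Category rep_comp_idl rep_comp_idr rep_comp_assoc.

End RepCategory.

Arguments RepCat {F} A.

Section RestrictionFunctor.
Variables (F : fieldType) (A B : algType F) (k : {lrmorphism A -> B}).

Lemma restrict_fin_dim (V : lmodType B) :
  finite_dimensional V -> finite_dimensional (restrict k V).
Proof.
move=> [n [e eP]]; exists n, e => x; have [c ->] := eP x; exists c.
apply: eq_bigr => i _.
rewrite -[LHS]/((c i)%:A *: (e i : V)) -[RHS]/(k (c i)%:A *: (e i : V)).
by rewrite rmorph_alg.
Qed.

Definition restrict_rep (V : RepCat B) : RepCat A :=
  Rep (restrict_fin_dim (rep_fin_dim V)).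

Definition restrict_hom (V W : RepCat B) (g : hom V W) :
    hom (restrict_rep V) (restrict_rep W) :=
  restrict_map k (g : {linear _ -> _}).

Fact restrict_hom_id V : restrict_hom (idmor V) = idmor (restrict_rep V).
Proof. exact: linear_ext. Qed.

Fact restrict_hom_comp U V W (g : hom V W) (f : hom U V) :
  restrict_hom (compose g f) = compose (restrict_hom g) (restrict_hom f).
Proof. exact: linear_ext. Qed.

Definition restriction_functor : functor (RepCat B) (RepCat A) :=
  Functor restrict_hom_id restrict_hom_comp.

End RestrictionFunctor.

(* A right R-module is a left module over the converse ring R^c, so that *)
(* [(r : R^c) *: m] stands for [m r].                                    *)

(* The subgroup of the free abelian group on M * N spanned by the relations *)
(* of the tensor product.                                                   *)
Inductive tensor_null (R : pzRingType) (M : lmodType R^c) (N : lmodType R) :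
    {freeg (M * N)%type / int} -> Prop :=
| tensor_null0 : tensor_null 0
| tensor_nullB x y : tensor_null x -> tensor_null y -> tensor_null (x - y)
| tensor_nullDl m m' n :
    tensor_null (<< (m + m', n) >> - (<< (m, n) >> + << (m', n) >>))
| tensor_nullDr m n n' :
    tensor_null (<< (m, n + n') >> - (<< (m, n) >> + << (m, n') >>))
| tensor_nullZ m (r : R) n :
    tensor_null (<< ((r : R^c) *: m, n) >> - << (m, r *: n) >>).

Section Tensor.
Variables (R : pzRingType) (M : lmodType R^c) (N : lmodType R).

Definition tensor_nullb : {pred {freeg (M * N)%type / int}} :=
  fun x => `[< tensor_null x >].

Fact tensor_null_closed : zmod_closed tensor_nullb.
Proof.
split=> [|x y /asboolP x0 /asboolP y0]; apply/asboolP; first exact: tensor_null0.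
exact: tensor_nullB.
Qed.

HB.instance Definition _ :=
  GRing.isZmodClosed.Build _ tensor_nullb tensor_null_closed.

Definition tensor : zmodType := Quotient.quot tensor_nullb.

Definition tmul (m : M) (n : N) : tensor :=
  \pi_(Quotient.quot tensor_nullb) << (m, n) >>.

Definition tensor_lift (Z : zmodType) (g : M -> N -> Z) (t : tensor) : Z :=
  fglift (fun p : M * N => g p.1 p.2 : zmodule Z)
    (repr (t : Quotient.quot tensor_nullb)).

Definition balanced (Z : zmodType) (g : M -> N -> Z) : Prop :=
  [/\ forall n, {morph g^~ n : m m' / m + m'},
      forall m, {morph g m : n n' / n + n'}
    & forall m (r : R) n, g ((r : R^c) *: m) n = g m (r *: n)].

Lemma tmul_balanced : balanced tmul.
Proof.
split=> [n m m'|m n n'|m r n]; rewrite /tmul -?pi_addr; apply/eqP;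
  rewrite -Quotient.idealrBE; apply/asboolP.
- exact: tensor_nullDl.
- exact: tensor_nullDr.
- exact: tensor_nullZ.
Qed.

Section Lift.
Variables (Z : zmodType) (g : M -> N -> Z).
Hypothesis g_bal : balanced g.

Let G := fglift (fun p : M * N => g p.1 p.2 : zmodule Z).

Let GB : zmod_morphism G. Proof. exact: lift_is_additive. Qed.

Let G1 m n : G << (m, n) >> = g m n.
Proof. by rewrite /G liftU scale1r. Qed.

Let GD x y : G (x + y) = G x + G y.
Proof.
have G0 : G 0 = 0 by rewrite -(subrr (0 : {freeg _ / int})) GB subrr.
by rewrite -[y in LHS]opprK GB -[- y]add0r GB G0 add0r opprK.
Qed.

Let G_null x : tensor_null x -> G x = 0.
Proof.
have [gDl gDr gZ] := g_bal.
elim=> [|{}x y _ x0 _ y0|m m' n|m n n'|m r n].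
- by rewrite -(subrr (0 : {freeg _ / int})) GB subrr.
- by rewrite GB x0 y0 subrr.
- by rewrite GB GD !G1 gDl subrr.
- by rewrite GB GD !G1 gDr subrr.
- by rewrite GB !G1 gZ subrr.
Qed.

Let tensor_lift_pi x :
  tensor_lift g (\pi_(Quotient.quot tensor_nullb) x : tensor) = G x.
Proof.
apply/eqP; rewrite -subr_eq0 /tensor_lift -/G -GB; apply/eqP/G_null.
by apply/asboolP; rewrite -[`[< _ >]]/(_ \in tensor_nullb) Quotient.idealrBE reprK.
Qed.

Lemma tensor_lift_tmul m n : tensor_lift g (tmul m n) = g m n.
Proof. by rewrite tensor_lift_pi G1. Qed.

Lemma tensor_lift_zmod_morphism : zmod_morphism (tensor_lift g).
Proof.
move=> t u; rewrite -[t](@reprK _ (Quotient.quot tensor_nullb)).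
rewrite -[u](@reprK _ (Quotient.quot tensor_nullb)).
rewrite -[X in tensor_lift g (_ + X)]pi_oppr -pi_addr.
by rewrite !tensor_lift_pi GB.
Qed.

End Lift.
End Tensor.

(* f (x) id_N *)
Definition tensor_map (R : pzRingType) (M M' : lmodType R^c) (N : lmodType R)
    (f : M -> M') : tensor M N -> tensor M' N :=
  tensor_lift (fun m n => tmul (f m) n).

Arguments tensor_map {R M M'} N f _.

Lemma tensor_map_balanced (R : pzRingType) (M M' : lmodType R^c)
    (N : lmodType R) (f : {linear M -> M'}) :
  balanced (fun m (n : N) => tmul (f m) n).
Proof.
have [Dl Dr Z] := @tmul_balanced _ M' N.
by split=> [n m m0|m n n0|m r n] /=; rewrite ?linearD ?linearZ; [apply: Dl | apply: Dr | apply: Z].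
Qed.

Lemma tensor_map_tmul (R : pzRingType) (M M' : lmodType R^c)
    (N : lmodType R) (f : {linear M -> M'}) m n :
  tensor_map N f (tmul m n) = tmul (f m) n.
Proof. exact: (tensor_lift_tmul (tensor_map_balanced N f) m n). Qed.

Definition pure_inclusion (F : fieldType) (A : algType F)
    (M M' : lmodType A^c) (f : {linear M -> M'}) : Prop :=
  injective f /\ forall N : rep A, injective (tensor_map N f).

(* B as a right A-module along k: b a = b * k a. *)
Definition right_module (R S : pzRingType) (k : R -> S) : Type := S.

Section RightModule.
Variables (R S : pzRingType) (k : {rmorphism R -> S}).

HB.instance Definition _ := GRing.Zmodule.on (right_module k).

Definition right_scale (r : R^c) (x : right_module k) : right_module k :=
  (x : S) * k r.

Fact right_scaleA a b x :
  right_scale a (right_scale b x) = right_scale (a * b) x.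
Proof. by rewrite /right_scale [k (_ * _)]rmorphM mulrA. Qed.

Fact right_scale1 : left_id 1 right_scale.
Proof. by move=> x; rewrite /right_scale [k 1]rmorph1 mulr1. Qed.

Fact right_scaleDr : right_distributive right_scale +%R.
Proof. by move=> a x y; apply: mulrDl. Qed.

Fact right_scaleDl x : {morph right_scale^~ x : a b / a + b}.
Proof. by move=> a b; rewrite /right_scale [k (_ + _)]rmorphD mulrDr. Qed.

HB.instance Definition _ := GRing.Zmodule_isLmodule.Build R^c (right_module k)
  right_scaleA right_scale1 right_scaleDr right_scaleDl.

Definition right_map (x : (R^c)^o) : right_module k := k x.

Fact right_map_linear : linear right_map.
Proof.
move=> a x y; rewrite -[RHS]/(k x * k a + k y) -rmorphM -rmorphD.
by [].
Qed.

HB.instance Definition _ :=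
  GRing.isLinear.Build R^c (R^c)^o (right_module k) _ right_map right_map_linear.

End RightModule.

Arguments right_map {R S} k x.

Definition pure_algebra_inclusion (F : fieldType) (A B : algType F)
    (k : {lrmorphism A -> B}) : Prop :=
  pure_inclusion (right_map k).

(* Main.v *)
Require Import Defs.
From mathcomp Require Import all_boot ssralg.
From HB Require Import structures.
From mathcomp Require Import ssrint generic_quotient ring_quotient.
From mathcomp.multinomials Require Import freeg.

(** Every finite-dimensional [A]-module [N] embeds, over [A], in the module
    [B (x)_A N] obtained from it by extension of scalars.  The embedding is the
    unit [n |-> 1 (x) n] of the adjunction between extension and restriction of
    scalars: up to the isomorphism of [N] with [A (x)_A N], it is the map
    [k (x) id_N], which purity makes injective (extension_unit_inj).

    It remains to see that [B (x)_A N] belongs to [Rep(B)].  If [e_1 .. e_p]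
    generate [B] as a right [A]-module and [f_1 .. f_q] span [N] over the ground
    field, then the [e_i (x) f_j] span [B (x)_A N] over the ground field: in
    [(sum_i e_i a_i) (x) n = sum_i e_i (x) (a_i n)] one expands each [a_i n] on
    the [f_j], and scalars pass through the tensor sign because [k] is
    [F]-linear (extension_fin_dim). *)

Set Implicit Arguments.
Unset Strict Implicit.
Unset Printing Implicit Defensive.

Import GRing.Theory.

Local Open Scope ring_scope.
Local Open Scope quotient_scope.

Lemma finitely_generated_fintype (R : pzRingType) (M : lmodType R)
    (I : finType) (e : I -> M) :
  (forall x, exists c : I -> R, x = \sum_i c i *: e i) ->
  finitely_generated M.
Proof.
move=> eP; exists #|I|, (fun i => e (enum_val i)) => x.
have [c ->] := eP x; exists (fun i => c (enum_val i)).
by rewrite (reindex _ (onW_bij _ (@enum_val_bij I))).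
Qed.

Lemma injective_monomorphism (F : fieldType) (A : algType F) (V W : RepCat A)
    (f : hom V W) :
  injective (f : {linear _ -> _}) -> monomorphism f.
Proof.
move=> f_inj U g h fg; apply: linear_ext => x; apply: f_inj.
exact: (congr1 (fun u : rep_hom U W => u x) fg).
Qed.

Section TensorTheory.
Variables (R : pzRingType) (M : lmodType R^c) (N : lmodType R).

(** Elementary tensors generate the tensor product as an abelian group.  Closure
    under differences is the only other premise, as it yields zero, opposites
    and sums, hence all integer combinations. *)
Lemma tensor_ind (P : tensor M N -> Prop) :
  (forall m n, P (tmul m n)) ->
  (forall t u, P t -> P u -> P (t - u)) ->
  forall t, P t.
Proof.
move=> Pmul PB.
have P0 : P 0 by rewrite -(subrr (tmul 0 0)); apply: PB.
have PN t : P t -> P (- t) by rewrite -[- t]sub0r; apply: PB.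
have PD t u : P t -> P u -> P (t + u).
  by move=> Pt /PN Pu; rewrite -[u]opprK; apply: PB.
pose Q := Quotient.quot (@tensor_nullb _ M N).
have piD (D E : {freeg (M * N)%type / int}) :
  \pi_Q (D + E) = (\pi_Q D + \pi_Q E : tensor M N) by rewrite pi_addr.
have piN (D : {freeg (M * N)%type / int}) :
  \pi_Q (- D) = (- \pi_Q D : tensor M N) by rewrite pi_oppr.
have pi0 : \pi_Q (0 : {freeg (M * N)%type / int}) = 0 :> tensor M N.
  by rewrite -[in LHS](subrr 0) piD piN subrr.
have PU k x : P (\pi_Q << k *g x >>).
  have Pn n : P (\pi_Q (<< x >> *+ n)).
    elim: n => [|n IHn]; first by rewrite mulr0n pi0.
    by rewrite mulrS piD; apply: PD => //; case: x {IHn} => m n0; apply: Pmul.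
  have -> : << k *g x >> = << x >> *~ k by rewrite freeg_mulz -mulrzl mulr1 intz.
  case: k => n; first by rewrite -pmulrn.
  by rewrite NegzE mulrNz -pmulrn piN; apply: PN.
move=> t; rewrite -[t](@reprK _ Q); elim/freeg_ind_dom0: (repr _) => [|k x D _ _ PD'].
  by rewrite pi0.
by rewrite piD; apply: PD.
Qed.

Lemma tmulDl m m' (n : N) : tmul (m + m' : M) n = tmul m n + tmul m' n.
Proof. by have [Dl _ _] := tmul_balanced M N; apply: Dl. Qed.

Lemma tmulDr (m : M) (n n' : N) : tmul m (n + n') = tmul m n + tmul m n'.
Proof. by have [_ Dr _] := tmul_balanced M N; apply: Dr. Qed.

Lemma tmulZ (m : M) (r : R) (n : N) :
  tmul ((r : R^c) *: m) n = tmul m (r *: n).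
Proof. by have [_ _ Z] := tmul_balanced M N; apply: Z. Qed.

Lemma tmul0l (n : N) : tmul (0 : M) n = 0.
Proof. by apply: (addrI (tmul 0 n)); rewrite -tmulDl !addr0. Qed.

Lemma tmul0r (m : M) : tmul m (0 : N) = 0.
Proof. by apply: (addrI (tmul m 0)); rewrite -tmulDr !addr0. Qed.

Lemma tmul_suml (I : finType) (m : I -> M) (n : N) :
  tmul (\sum_i m i) n = \sum_i tmul (m i) n.
Proof.
by apply: (big_morph (fun m => tmul m n) _ (tmul0l n)) => m1 m2; apply: tmulDl.
Qed.

Lemma tmul_sumr (I : finType) (m : M) (n : I -> N) :
  tmul m (\sum_i n i) = \sum_i tmul m (n i).
Proof. by apply: (big_morph (tmul m) _ (tmul0r m)) => m1 m2; apply: tmulDr. Qed.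

Lemma tensor_mapB (M' : lmodType R^c) (f : {linear M -> M'}) :
  {morph tensor_map N f : t u / t - u}.
Proof. exact: tensor_lift_zmod_morphism (tensor_map_balanced N f). Qed.

End TensorTheory.

(** The action map [a (x) n |-> a n] is a retraction of [n |-> 1 (x) n]. *)
Lemma tmul1_inj (R : pzRingType) (N : lmodType R) :
  injective (tmul (1 : (R^c)^o) : N -> tensor (R^c)^o N).
Proof.
pose act (a : (R^c)^o) (n : N) : N := (a : R) *: n.
have act_bal : balanced act.
  split=> [n a a'|a n n'|a r n]; rewrite /act; [exact: scalerDl|exact: scalerDr|].
  by rewrite scalerA.
apply: (can_inj (g := tensor_lift act)) => n.
by rewrite (tensor_lift_tmul act_bal) /act scale1r.
Qed.

Section ScalarExtension.
Variables (R S : pzRingType) (k : {rmorphism R -> S}).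

Definition left_mult (b x : right_module k) : right_module k := (b : S) * x.

Fact left_mult_linear b : linear (left_mult b).
Proof.
move=> a x y; rewrite /left_mult mulrDr; congr (_ + _).
exact: (mulrA (b : S) (x : S) (k a)).
Qed.

HB.instance Definition _ b :=
  GRing.isLinear.Build R^c (right_module k) (right_module k) _ (left_mult b)
    (left_mult_linear b).

Variable N : lmodType R.

(** The name serves as a key for the left [S]-module structure, which the
    tensor product does not carry in general. *)
Definition scalar_extension : Type := tensor (right_module k) N.

HB.instance Definition _ := GRing.Zmodule.on scalar_extension.

Definition extension_scale (b : S) (t : scalar_extension) : scalar_extension :=
  tensor_map N (left_mult b) t.

Lemma extension_scale_tmul b (x : right_module k) n :
  extension_scale b (tmul x n) = tmul (b * x : right_module k) n.
Proof. exact: tensor_map_tmul. Qed.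

Lemma extension_scaleB b : {morph extension_scale b : t u / t - u}.
Proof. exact: tensor_mapB. Qed.

Fact extension_scaleA a b t :
  extension_scale a (extension_scale b t) = extension_scale (a * b) t.
Proof.
elim/tensor_ind: t => [x n|t u IHt IHu].
  by rewrite !extension_scale_tmul mulrA.
by rewrite !extension_scaleB IHt IHu.
Qed.

Fact extension_scale1 : left_id 1 extension_scale.
Proof.
elim/tensor_ind=> [x n|t u IHt IHu]; first by rewrite extension_scale_tmul mul1r.
by rewrite extension_scaleB IHt IHu.
Qed.

Fact extension_scaleDr : right_distributive extension_scale +%R.
Proof.
move=> b t u; have s0 : extension_scale b 0 = 0.
  by rewrite -[in LHS](subrr 0) extension_scaleB subrr.
by rewrite -[u in LHS]opprK -[- u]sub0r !extension_scaleB s0 sub0r opprK.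
Qed.

Fact extension_scaleDl t : {morph extension_scale^~ t : a b / a + b}.
Proof.
move=> a b; elim/tensor_ind: t => [x n|t u IHt IHu].
  by rewrite !extension_scale_tmul mulrDl tmulDl.
by rewrite !extension_scaleB IHt IHu opprD addrACA.
Qed.

HB.instance Definition _ := GRing.Zmodule_isLmodule.Build S scalar_extension
  extension_scaleA extension_scale1 extension_scaleDr extension_scaleDl.

Definition extension_unit (n : N) : restrict k scalar_extension :=
  tmul (1 : right_module k) n.

Fact extension_unit_linear : linear extension_unit.
Proof.
move=> a x y; rewrite /extension_unit tmulDr -tmulZ; congr (_ + _).
rewrite -[RHS]/(extension_scale (k a) (tmul (1 : right_module k) x)).
by rewrite extension_scale_tmul mulr1 -[X in tmul X x]/(1 * k a) mul1r.
Qed.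

HB.instance Definition _ :=
  GRing.isLinear.Build R N (restrict k scalar_extension) _ extension_unit
    extension_unit_linear.

(** [k (x) id_N] maps [1 (x) n] to [k 1 (x) n = 1 (x) n], so the unit factors
    through it. *)
Lemma extension_unit_inj :
  injective (tensor_map N (right_map k)) -> injective extension_unit.
Proof.
move=> k_inj; have unitE n :
    tensor_map N (right_map k) (tmul (1 : (R^c)^o) n) = extension_unit n.
  by rewrite tensor_map_tmul /extension_unit /right_map [k 1]rmorph1.
by move=> x y; rewrite -!unitE => /k_inj; apply: tmul1_inj.
Qed.

End ScalarExtension.

Section FiniteDimension.
Variables (F : fieldType) (A B : algType F) (k : {lrmorphism A -> B}).

(** A scalar of the ground field is central in [B] and is the image by [k] of
    the same scalar of [A], so it can be moved from the left of [x] to its right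
    and then across the tensor sign. *)
Lemma extension_scale_alg (N : lmodType A) (c : F) (x : right_module k) (n : N) :
  (c%:A : B) *: (tmul x n : scalar_extension k N) = tmul x (c%:A *: n).
Proof.
rewrite -[LHS]/(extension_scale _ _) extension_scale_tmul -tmulZ.
congr tmul; rewrite -[RHS]/((x : B) * k c%:A).
by rewrite rmorph_alg mulr_algl mulr_algr.
Qed.

(** The tensors of the generators of [B] by the spanning vectors of [N] span:
    these combinations contain the elementary tensors and are closed under
    differences. *)
Lemma extension_fin_dim (N : lmodType A) :
  finitely_generated (right_module k) -> finite_dimensional N ->
  finite_dimensional (scalar_extension k N).
Proof.
move=> [p [e eP]] [q [f fP]].
pose ef (ij : 'I_p * 'I_q) : restrict (in_alg B) (scalar_extension k N) :=
  tmul (e ij.1) (f ij.2 : N).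
apply: (finitely_generated_fintype (e := ef)); elim/tensor_ind=> [b n|].
  have [a ->] := eP b.
  have [c cP] := fin_all_exists (fun i => fP ((a i : A) *: n)).
  exists (fun ij => c ij.1 ij.2).
  rewrite -(pair_bigA _ (fun i j => c i j *: ef (i, j))) tmul_suml.
  apply: eq_bigr => i _; rewrite tmulZ cP tmul_sumr; apply: eq_bigr => j _.
  by rewrite -[RHS]/((c i j)%:A *: (ef (i, j) : scalar_extension k N)) extension_scale_alg.
move=> _ _ [c ->] [d ->]; exists (fun ij => c ij - d ij).
by rewrite -sumrB; apply: eq_bigr => ij _; rewrite scalerBl.
Qed.

End FiniteDimension.

Theorem proposition4p14 (F : fieldType) (A B : algType F)
    (k : {lrmorphism A -> B})
    (k_pure : pure_algebra_inclusion k)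
    (B_fg : finitely_generated (right_module k)) :
  dominant (restriction_functor k).
Proof.
move=> N; pose V : rep A := N.
exists (Rep (extension_fin_dim B_fg (rep_fin_dim V))).
exists (@extension_unit _ _ k V : {linear _ -> _}).
apply: injective_monomorphism; apply: extension_unit_inj.
by case: k_pure => _; apply.
Qed.
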